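(* Let $(X_t)_{t\in\mathbb{N}}$ be real-valued random variables on $\Omega$ with $X_t$ $\mathcal{F}_t$-measurable for each $t$. Let $\mathcal{P}$ be a family of probability measures on $\mathcal{F}$ such that under each $\mathbb{P}\in\mathcal{P}$ the sequence $(X_t)_{t\in\mathbb{N}}$ is i.i.d. with $\mathbb{E}_{\mathbb{P}}[|X_1|]<\infty$, and assume the centered uniform integrability condition $$\lim_{K\to\infty}\sup_{\mathbb{P}\in\mathcal{P}}\mathbb{E}_{\mathbb{P}}\Big[|X_1-\mathbb{E}_{\mathbb{P}}[X_1]|\,\mathbf{1}_{\{|X_1-\mathbb{E}_{\mathbb{P}}[X_1]|>K\}}\Big]=0.$$ Let $A_{\mathrm{div}}=\big\{\lim_{t\to\infty}\frac1t\sum_{i=1}^tX_i \text{ does not exist in }\mathbb{R}\big\}$. Then $\mu^*(A_{\mathrm{div}})=0$.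
   Context: Standing setup: $(\Omega, (\mathcal{F}_t)_{t\in\mathbb{N}_0}, \mathcal{F})$ is a filtered measurable space with $\mathcal{F} = \sigma\big(\bigcup_{t} \mathcal{F}_t\big)$. A stopping time is a map $\tau:\Omega\to\mathbb{N}_0\cup\{\infty\}$ with $\{\tau \le t\}\in\mathcal{F}_t$ for all $t$; $\mathcal{T}$ denotes the set of all stopping times. The inverse-capital measure of $A\subseteq\Omega$ with respect to the family $\mathcal{P}$ is $\mu^*(A) = \inf_{\tau\in\mathcal{T}:\, A\subseteq\{\tau<\infty\}} \sup_{\mathbb{P}\in\mathcal{P}} \mathbb{P}(\tau<\infty)$. *)

(* Defs.v *)
From HB Require Import structures.
From mathcomp Require Import all_boot all_order all_algebra.
From mathcomp Require Import all_classical all_reals all_analysis.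
Set Implicit Arguments. Unset Strict Implicit. Unset Printing Implicit Defensive.
Import Order.TTheory GRing.Theory Num.Theory.
Import numFieldNormedType.Exports.
Local Open Scope classical_set_scope.
Local Open Scope ring_scope.

Definition filtration_of {d} (Omega : measurableType d)
  (F : nat -> set (set Omega)) : Prop :=
  (forall t, sigma_algebra setT (F t)) /\
  (forall s t, (s <= t)%N -> F s `<=` F t) /\
  (@measurable d Omega = <<s \bigcup_t F t >>).

(* Stopping times: tau : Omega -> N_0 ∪ {oo}, encoded as option nat
   (None = infinity), with {tau <= t} in F_t for all t. *)
Definition stopping_time {d} {Omega : measurableType d}
  (F : nat -> set (set Omega)) (tau : Omega -> option nat) : Prop :=
  forall t : nat, F t [set w | exists s, tau w = Some s /\ (s <= t)%N].

Definition finite_time {Omega : Type} (tau : Omega -> option nat) : set Omega :=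
  [set w | tau w != None].

(* supremum over the family of probability measures of nonnegative
   quantities; 0 is included so that the sup over an empty family is 0 *)
Definition supP {d} {Omega : measurableType d} {R : realType}
  (Pfam : set (probability Omega R)) (f : probability Omega R -> \bar R) : \bar R :=
  ereal_sup ([set 0%E] `|` [set f P | P in Pfam]).

Definition mu_star {d} {Omega : measurableType d} {R : realType}
  (F : nat -> set (set Omega)) (Pfam : set (probability Omega R)) (A : set Omega)
  : \bar R :=
  ereal_inf [set supP Pfam (fun P => P (finite_time tau))
            | tau in [set tau | stopping_time F tau /\ A `<=` finite_time tau]].

Definition iid {d} {Omega : measurableType d} {R : realType}
  (P : probability Omega R) (X : nat -> Omega -> R) : Prop :=
  (forall (s : seq nat) (B : nat -> set R),
      uniq s -> all (fun i => (0 < i)%N) s ->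
      (forall i, measurable (B i)) ->
      P (\bigcap_(i in [set` s]) (X i @^-1` B i)) =
      (\prod_(i <- s) P (X i @^-1` B i))%E) /\
  (forall i (B : set R), (0 < i)%N -> measurable B ->
      P (X i @^-1` B) = P (X 1%N @^-1` B)).

Definition A_div {Omega : Type} {R : realType} (X : nat -> Omega -> R) : set Omega :=
  [set w | ~ exists l : R,
      (fun t : nat => (t%:R)^-1 * \sum_(1 <= i < t.+1) X i w) @ \oo --> l].

(* Main.v *)
Require Import Defs.
From HB Require Import structures.
From mathcomp Require Import all_boot all_order all_algebra.
From mathcomp Require Import all_classical all_reals all_analysis.
From mathcomp Require Import measurable_realfun zify ring lra.
Import Order.TTheory GRing.Theory Num.Theory.
Import numFieldNormedType.Exports.
Local Open Scope classical_set_scope.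
Local Open Scope ring_scope.
Set Implicit Arguments. Unset Strict Implicit. Unset Printing Implicit Defensive.

(** The averages [S_m / m] converge as soon as, for every [k],
[|S_m / m - S_n / n| <= 1 / (k + 1)] for all [m >= n], where [n = n_k] is a deterministic
time. The first violation of one of these bounds is a stopping time that is finite on
the divergence event, so it suffices to choose [n_k] with
[P (exists m >= n_k, |S_m / m - S_n / n| > 1 / (k + 1)) <= e / 2^(k+1)] uniformly in [P].

This is a uniform strong law for the centred variables [Y], and Etemadi's argument
makes it quantitative: pairwise independence, truncation at level [k] and Chebyshev
give a weak law at time [k] with error [E (weight k |Y|)]; along a geometric sequence of
times started at [n] these errors sum to a multiple of
[E (Y^2 / (n + |Y|)) <= E (|Y| 1{|Y| > K}) + K^2 / n], which is small uniformly in [P] by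
uniform integrability. The law for [|Y|] then controls the gaps between these times. *)

(** * Bounded random variables and products of independent ones *)

Definition bounded_rv {T : Type} {R : realType} (U : T -> R) : Prop :=
  exists M : R, forall w, `|U w| <= M.

Lemma bounded_rv_integrable d (T : measurableType d) (R : realType)
    (P : probability T R) (U : T -> R) :
  measurable_fun setT U -> bounded_rv U -> P.-integrable setT (EFin \o U).
Proof.
move=> mU [M UM].
apply: measurable_bounded_integrable => //; first by rewrite -ge0_fin_numE// fin_num_measure.
exists M; split; first exact: num_real.
by move=> N MN w _ /=; rewrite (le_trans (UM w))// ltW.
Qed.

(** The law of [(U, V)] agrees with the product of the marginal laws on rectangles, hence everywhere
    by uniqueness of the product measure; Fubini then splits the integral of [x * y]. *)
Lemma Rintegral_mul_indep d (T : measurableType d) (R : realType)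
    (P : probability T R) (U V : T -> R) :
  measurable_fun setT U -> measurable_fun setT V ->
  bounded_rv U -> bounded_rv V ->
  (forall A B : set R, measurable A -> measurable B ->
    P (U @^-1` A `&` V @^-1` B) = (P (U @^-1` A) * P (V @^-1` B))%E) ->
  \int[P]_w (U w * V w) = \int[P]_w U w * \int[P]_w V w.
Proof.
move=> mU mV bU bV UV.
have iU := bounded_rv_integrable P mU bU.
have iV := bounded_rv_integrable P mV bV.
have mUV : measurable_fun setT (fun w => (U w, V w)) by exact: measurable_fun_pair.
pose pU : {RV P >-> R} := HB.pack U (isMeasurableFun.Build _ _ _ _ _ mU).
pose pV : {RV P >-> R} := HB.pack V (isMeasurableFun.Build _ _ _ _ _ mV).
pose pUV : {RV P >-> (R * R)%type} :=
  HB.pack (fun w => (U w, V w)) (isMeasurableFun.Build _ _ _ _ _ mUV).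
pose D1 := distribution P pU; pose D2 := distribution P pV.
pose D := distribution P pUV.
have DE A : measurable A -> (D1 \x D2)%E A = D A.
  by apply: product_measure_unique => A' B' mA mB; rewrite -UV.
pose f (z : R * R) : \bar R := (z.1 * z.2)%:E.
have mf : @measurable_fun _ _ (R * R)%type (\bar R) setT f.
  apply/measurable_EFinP; exact: measurable_funM.
have iUV : P.-integrable setT (f \o pUV).
  apply: (bounded_rv_integrable P (U := fun w => U w * V w)).
    exact: measurable_funM.
  case: bU bV => [M UM] [N VN]; exists (M * N) => w.
  by rewrite normrM ler_pM.
have iD : (D1 \x D2)%E.-integrable setT f.
  apply/integrableP; split => //.
  rewrite (eq_measure_integral D); last by move=> A mA _; exact: DE.
  by have /integrableP[] := integrable_pushforward mUV mf iUV measurableT.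
have E1 : (\int[P]_w (U w * V w)%:E = \int[D]_z f z)%E.
  by rewrite integral_distribution.
have E2 : (\int[D]_z f z = \int[D1]_x \int[D2]_y f (x, y))%E.
  rewrite integral12_prod_meas1//.
  by apply/esym/eq_measure_integral => A mA _; exact: DE.
have mid : measurable_fun setT (EFin : R -> \bar R) by exact/measurable_EFinP.
have E3 x : (\int[D2]_y f (x, y) = x%:E * (\int[P]_w V w)%:E)%E.
  rewrite integral_distribution//=.
  - under eq_integral do rewrite /f/= EFinM.
    rewrite integralZl//.
    by rewrite /Rintegral fineK// integrable_fin_num.
  - exact: (measurable_fun_pair2 x mf).
  - have := integrableZl measurableT x iV.
    by apply: eq_integrable => // w _ /=; rewrite EFinM.
rewrite /Rintegral E1 E2.
rewrite (eq_integral (fun x : R => x%:E * (\int[P]_w V w)%:E)%E); last first.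
  by move=> x _; exact: E3.
have iD1 : D1.-integrable setT (EFin : R -> \bar R).
  exact: (integrable_pushforward mU mid iU measurableT).
rewrite integralZr// integral_distribution//=.
by rewrite fineM//= integrable_fin_num.
Qed.

Lemma Rintegral_cst_probability d (T : measurableType d) (R : realType)
    (P : probability T R) (c : R) : \int[P]_w c = c.
Proof.
rewrite Rintegral_cst// [X in fine X](_ : _ = 1%E) ?mulr1//.
exact: probability_setT.
Qed.

Lemma measurable_gt_cst d (T : measurableType d) (R : realType) (f : T -> R) (c : R) :
  measurable_fun setT f -> measurable [set w | c < f w].
Proof.
move=> mf; rewrite (_ : [set w | c < f w] = setT `&` f @^-1` `]c, +oo[).
  exact: mf.
by apply/seteqP; split=> w /=; rewrite in_itv/= andbT => // -[].
Qed.

(** * Pairwise i.i.d. sequences and their second moments *)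

(** Independence of pairs is all that Etemadi's argument uses, and it passes to truncations,
    centrings and absolute values. *)
Definition pairwise_iid d (T : measurableType d) (R : realType)
    (P : probability T R) (xi : nat -> T -> R) : Prop :=
  [/\ forall i, measurable_fun setT (xi i),
      forall i j (A B : set R), i != j -> measurable A -> measurable B ->
        P (xi i @^-1` A `&` xi j @^-1` B) =
        (P (xi i @^-1` A) * P (xi j @^-1` B))%E
    & forall i (B : set R), measurable B ->
        P (xi i @^-1` B) = P (xi 0%N @^-1` B)].

Lemma pairwise_iid_comp d (T : measurableType d) (R : realType)
    (P : probability T R) (xi : nat -> T -> R) (g : R -> R) :
  measurable_fun setT g -> pairwise_iid P xi ->
  pairwise_iid P (fun i w => g (xi i w)).
Proof.
move=> mg [mxi ind idd].
have mgp (B : set R) : measurable B -> measurable (g @^-1` B).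
  by move=> mB; rewrite -[X in measurable X]setTI; exact: mg.
split => [i|i j A B ij mA mB|i B mB].
- exact: measurableT_comp.
- by apply: (ind i j (g @^-1` A) (g @^-1` B)) => //; exact: mgp.
- by apply: (idd i (g @^-1` B)); exact: mgp.
Qed.

Lemma pairwise_iid_Rintegral d (T : measurableType d) (R : realType)
    (P : probability T R) (xi : nat -> T -> R) i :
  pairwise_iid P xi -> (forall j, bounded_rv (xi j)) ->
  \int[P]_w xi i w = \int[P]_w xi 0%N w.
Proof.
move=> [mxi _ idd] bxi.
have mid : measurable_fun setT (EFin : R -> \bar R) by exact/measurable_EFinP.
pose p j : {RV P >-> R} := HB.pack (xi j) (isMeasurableFun.Build _ _ _ _ _ (mxi j)).
have E j : (\int[P]_w (xi j w)%:E = \int[distribution P (p j)]_x x%:E)%E.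
  by rewrite integral_distribution//; exact: (bounded_rv_integrable P (mxi j) (bxi j)).
rewrite /Rintegral !E; congr fine.
by apply: eq_measure_integral => A mA _; exact: idd.
Qed.

Lemma bounded_rv_sum (T : Type) (R : realType) (U : nat -> T -> R) k :
  (forall i, bounded_rv (U i)) -> bounded_rv (fun w => \sum_(i < k) U i w).
Proof.
move=> bU; elim: k => [|k [M IH]].
  by exists 0 => w; rewrite big_ord0 normr0.
have [N UN] := bU k; exists (M + N) => w.
by rewrite big_ord_recr/= (le_trans (ler_normD _ _))// lerD.
Qed.

Lemma bounded_rvM (T : Type) (R : realType) (U V : T -> R) :
  bounded_rv U -> bounded_rv V -> bounded_rv (fun w => U w * V w).
Proof.
by move=> [M UM] [N VN]; exists (M * N) => w; rewrite normrM ler_pM.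
Qed.

(** Expanding the square of the partial sums one index at a time leaves cross terms, which vanish by
    pairwise independence and centring. *)
Lemma second_moment_sum d (T : measurableType d) (R : realType)
    (P : probability T R) (U : nat -> T -> R) k :
  pairwise_iid P U -> (forall i, bounded_rv (U i)) ->
  \int[P]_w U 0%N w = 0 ->
  \int[P]_w (\sum_(i < k) U i w) ^+ 2 = k%:R * \int[P]_w (U 0%N w) ^+ 2.
Proof.
move=> iU bU U0; have [mU ind idd] := iU.
have mS n : measurable_fun setT (fun w => \sum_(i < n) U i w).
  exact: measurable_sum.
have bS n := bounded_rv_sum n bU.
have bi (V : T -> R) : measurable_fun setT V -> bounded_rv V -> P.-integrable setT (EFin \o V).
  exact: bounded_rv_integrable.
have cross n m : (n <= m)%N -> \int[P]_w ((\sum_(i < n) U i w) * U m w) = 0.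
  elim: n => [|n IH] nm.
    under eq_Rintegral do rewrite big_ord0 mul0r.
    by rewrite Rintegral_cst// mul0r.
  under eq_Rintegral do rewrite big_ord_recr/= mulrDl.
  rewrite RintegralD//; [|apply: bi|apply: bi].
  - rewrite IH ?(ltnW nm)// add0r Rintegral_mul_indep//.
      by rewrite (pairwise_iid_Rintegral _ iU)// U0 mul0r.
    by move=> A B mA mB; apply: ind => //; rewrite neq_ltn nm.
  - exact: (measurable_funM (mS n) (mU m)).
  - exact: (bounded_rvM (bS n) (bU m)).
  - exact: (measurable_funM (mU n) (mU m)).
  - exact: (bounded_rvM (bU n) (bU m)).
have sq n : \int[P]_w (U n w) ^+ 2 = \int[P]_w (U 0%N w) ^+ 2.
  have mg : measurable_fun setT (fun x : R => x ^+ 2) by exact: measurable_funX.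
  apply: (pairwise_iid_Rintegral n (pairwise_iid_comp mg iU)) => j.
  exact: (bounded_rvM (bU j) (bU j)).
elim: k => [|k IH].
  under eq_Rintegral do rewrite big_ord0 expr0n/=.
  by rewrite Rintegral_cst// !mul0r.
under eq_Rintegral => w _.
  rewrite big_ord_recr/= (_ : _ ^+ 2 = (\sum_(i < k) U i w) ^+ 2 +
    (2 * ((\sum_(i < k) U i w) * U k w) + (U k w) ^+ 2)); last by ring.
  over.
have m1 : measurable_fun setT (fun w => (\sum_(i < k) U i w) * U k w).
  exact: (measurable_funM (mS k) (mU k)).
have b1 : bounded_rv (fun w => (\sum_(i < k) U i w) * U k w) by exact: (bounded_rvM (bS k) (bU k)).
have i1 : P.-integrable setT (EFin \o (fun w => (2 * ((\sum_(i < k) U i w) * U k w)))).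
  apply: bi; first exact: (measurable_funM (measurable_cst _) m1).
  by apply: (bounded_rvM (U := cst 2) _ b1); exists `|2| => w.
have i2 : P.-integrable setT (EFin \o (fun w => (U k w) ^+ 2)).
  by apply: bi; [exact: measurable_funX|exact: (bounded_rvM (bU k) (bU k))].
rewrite RintegralD//.
- rewrite RintegralD// RintegralZl//; last exact: bi.
  by rewrite cross// mulr0 add0r IH sq -natr1 mulrDl mul1r.
- by apply: bi; [exact: measurable_funX|exact: (bounded_rvM (bS k) (bS k))].
- exact: (integrableD measurableT i1 i2).
Qed.

(** Chebyshev's inequality, from Markov's inequality for the square. *)
Lemma second_moment_tail d (T : measurableType d) (R : realType)
    (P : probability T R) (S : T -> R) (c : R) :
  0 < c -> measurable_fun setT S -> P.-integrable setT (EFin \o (fun w => S w ^+ 2)) ->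
  (P [set w | (c < `|S w|)%R] <= (\int[P]_w (S w) ^+ 2 / c ^+ 2)%:E)%E.
Proof.
move=> c0 mS iS2.
pose p : {RV P >-> R} := HB.pack S (isMeasurableFun.Build _ _ _ _ _ mS).
have mg : measurable_fun setT (fun x : R => x ^+ 2) by exact: measurable_funX.
have := @markov _ _ _ P p (fun x : R => x ^+ 2) c c0 mg.
rewrite unlock => /(_ _ _)/= H.
have {H} : ((c ^+ 2)%:E * P [set x | (c%:E <= `|(S x)%:E|)%E] <=
  (\int[P]_w (S w ^+ 2))%:E)%E.
  rewrite /Rintegral fineK ?integrable_fin_num//.
  under eq_integral do rewrite -real_normK ?num_real//.
  apply: H; first by move=> r _; exact: sqr_ge0.
  by move=> x y; rewrite !nnegrE => x0 y0 xy; rewrite ler_pXn2r.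
move=> H.
rewrite EFinM lee_pdivlMr ?exprn_gt0// muleC (le_trans _ H)//.
rewrite lee_pmul2l ?lte_fin ?exprn_gt0//.
rewrite le_measure ?inE//.
- by apply: measurable_gt_cst; exact: measurableT_comp.
- rewrite (_ : [set _ | _] = ~` [set w | (- c < - `|S w|)%R]); last first.
    by apply/seteqP; split=> w /=; rewrite ltrN2 lee_fin leNgt => /negP.
  apply: measurableC; apply: measurable_gt_cst.
  by apply: measurableT_comp => //; exact: measurableT_comp.
- by move=> w /=; rewrite lee_fin => /ltW.
Qed.

(* A smooth majorant of both [k * 1{y > k}] and [y^2 * 1{y <= k} / k]. It is
comparable to [k] times the [k]-derivative of [- y^2 / (k + y)], so its sum over a
geometrically growing sequence of [k] telescopes. *)
Definition weight {R : realType} (k y : R) : R := 4 * k * y ^+ 2 / (k + y) ^+ 2.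

(** * Inequalities for the truncation weight *)

Section weight_theory.
Context {R : realType}.
Implicit Types k y : R.

Lemma weight_ge0 k y : 0 <= k -> 0 <= weight k y.
Proof.
move=> k0; rewrite /weight divr_ge0 ?sqr_ge0// mulr_ge0 ?sqr_ge0//.
by rewrite mulr_ge0.
Qed.

Lemma weight_le k y : 0 < k -> 0 <= y -> weight k y <= 4 * k.
Proof.
move=> k0 y0; rewrite /weight ler_pdivrMr; last by rewrite exprn_gt0// ltr_wpDr.
rewrite ler_wpM2l//; first lra.
by nra.
Qed.

(** The factor 4 in [weight] is calibrated for this bound, where [k + y <= 2 * y], and for
    [le_weight_body], where [k + y <= 2 * k]. *)
Lemma le_weight_tail k y : 0 < k -> k <= y -> k <= weight k y.
Proof.
move=> k0 ky; rewrite /weight ler_pdivlMr; last by rewrite exprn_gt0//; lra.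
rewrite [4 * k]mulrC -mulrA ler_pM2l//; nra.
Qed.

Lemma le_weight_body k y : 0 < k -> 0 <= y -> y <= k -> y ^+ 2 <= k * weight k y.
Proof.
move=> k0 y0 yk; rewrite /weight mulrA ler_pdivlMr; last by rewrite exprn_gt0//; lra.
rewrite (_ : k * (4 * k * y ^+ 2) = y ^+ 2 * (4 * k ^+ 2)); last by ring.
by rewrite ler_wpM2l ?sqr_ge0//; nra.
Qed.

(** The difference on the right is [y ^+ 2 * (k' - k) / ((k + y) * (k' + y))]. Here
    [k' + y <= 2 * (k + y)] and [k' - k >= k / q], so it is at least [weight k y / (8 * q)]. *)
Lemma weight_telescope k k' q y : 0 < k -> 0 <= y -> k <= q * (k' - k) ->
  k' <= 2 * k -> 0 < q ->
  weight k y <= 8 * q * (y ^+ 2 / (k + y) - y ^+ 2 / (k' + y)).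
Proof.
move=> k0 y0 kq k'k q0.
have kk' : k < k' by nra.
have ky : 0 < k + y by lra.
have k'y : 0 < k' + y by lra.
rewrite (_ : 8 * q * _ = (8 * q * (k' - k) * (k + y) / (k' + y)) * (y ^+ 2 / (k + y) ^+ 2)).
  rewrite (_ : weight k y = (4 * k) * (y ^+ 2 / (k + y) ^+ 2)).
    apply: ler_wpM2r; first by rewrite divr_ge0// sqr_ge0.
    by rewrite ler_pdivlMr//; nra.
  by rewrite /weight mulrA.
by field; rewrite !gt_eqF.
Qed.

(** Above [K] the left side is at most [y]; below [K] its numerator is at most [K ^+ 2] and its
    denominator at least [n]. The free level [K] lets uniform integrability fix [K] first and [n]
    afterwards. *)
Lemma weight_potential_le (n y K : R) : 0 < n -> 0 <= y ->
  y ^+ 2 / (n + y) <= y * ((K < y)%R : bool)%:R + K ^+ 2 / n.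
Proof.
move=> n0 y0; have [Ky|yK] := ltP K y.
  rewrite mulr1 -[leLHS]addr0 lerD ?divr_ge0 ?sqr_ge0 ?(ltW n0)//.
  rewrite ler_pdivrMr; nra.
rewrite mulr0 add0r ler_pM ?sqr_ge0 ?invr_ge0//; [lra|nra|].
by rewrite lef_pV2 ?posrE//; lra.
Qed.

End weight_theory.

(** * Integrability of weights and tails, and the weak law at a single time *)

Lemma measurable_gt_ind d (T : measurableType d) (R : realType) (f : T -> R) (c : R) :
  measurable_fun setT f ->
  measurable_fun setT (fun w => ((c < f w)%R : bool)%:R : R).
Proof.
move=> mf; rewrite (_ : (fun w => _) = \1_[set w | c < f w]).
  by apply: measurable_indic; exact: measurable_gt_cst.
by apply/funext => w; rewrite indicE; congr (_%:R); congr nat_of_bool;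
  apply/idP/idP; rewrite inE.
Qed.

Lemma probability_gt d (T : measurableType d) (R : realType) (P : probability T R)
    (f : T -> R) (c : R) : measurable_fun setT f ->
  P [set w | c < f w] = (\int[P]_w ((c < f w)%R : bool)%:R)%:E.
Proof.
move=> mf; have mA := measurable_gt_cst c mf.
have E : (\int[P]_w (((c < f w)%R : bool)%:R)%:E = P [set w | (c < f w)%R])%E.
  rewrite -[X in _ = P X]setIT -integral_indic//; apply: eq_integral => w _.
  rewrite indicE; congr (_%:R)%:E; congr nat_of_bool.
  by apply/idP/idP; rewrite inE.
by rewrite /Rintegral E fineK// fin_num_measure.
Qed.

Lemma weight_measurable d (T : measurableType d) (R : realType) (f : T -> R) (k : R) :
  0 < k -> measurable_fun setT f -> measurable_fun setT (fun w => weight k `|f w|).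
Proof.
move=> k0 mf; rewrite /weight.
have mn : measurable_fun setT (fun w => `|f w|) by exact: measurableT_comp.
apply: measurable_funM.
  by apply: measurable_funM => //; exact: measurable_funX.
have mc : measurable_fun setT (fun x : R => (k + `|x|) ^- 2).
  apply: continuous_measurable_fun => x.
  apply: cvgV; first by rewrite gt_eqF// exprn_gt0// ltr_wpDr.
  apply: (cvgM (f := fun x => k + `|x|) (g := fun x => k + `|x|));
    by apply: cvgD; [exact: cvg_cst|exact: norm_continuous].
exact: (measurableT_comp mc).
Qed.

Lemma weight_integrable d (T : measurableType d) (R : realType) (P : probability T R)
    (f : T -> R) (k : R) : 0 < k -> measurable_fun setT f ->
  P.-integrable setT (EFin \o (fun w => weight k `|f w|)).
Proof.
move=> k0 mf; apply: bounded_rv_integrable; first exact: weight_measurable.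
exists (4 * k) => w; rewrite ger0_norm ?weight_ge0 ?(ltW k0)//.
exact: weight_le.
Qed.

Lemma tail_integrable d (T : measurableType d) (R : realType) (P : probability T R)
    (f : T -> R) (c : R) : P.-integrable setT (EFin \o f) ->
  P.-integrable setT (EFin \o (fun w => f w * ((c < `|f w|)%R : bool)%:R)).
Proof.
move=> fi; have mf : measurable_fun setT f by apply/measurable_EFinP; case/integrableP : fi.
apply: (le_integrable measurableT _ _ fi).
  apply/measurable_EFinP; apply: measurable_funM => //.
  by apply: measurable_gt_ind; exact: measurableT_comp.
move=> w _ /=; rewrite lee_fin normrM.
by case: (c < _); rewrite ?normr1 ?mulr1// normr0 mulr0.
Qed.

Lemma norm_tail_integrable d (T : measurableType d) (R : realType)
    (P : probability T R) (f : T -> R) (c : R) : P.-integrable setT (EFin \o f) ->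
  P.-integrable setT (EFin \o (fun w => `|f w| * ((c < `|f w|)%R : bool)%:R)).
Proof.
move=> fi; have := integrable_norm (tail_integrable c fi).
apply: eq_integrable => // w _ /=.
by rewrite normrM [X in _ * X]ger0_norm.
Qed.

(** Truncation is at the level [k] that also counts the summands. A union bound for the event that
    some summand is truncated contributes the 1, and Chebyshev for the truncated centred sum
    contributes [4 / e ^+ 2]. *)
Lemma weak_law d (T : measurableType d) (R : realType) (P : probability T R)
    (xi : nat -> T -> R) (k : nat) (e : R) :
  pairwise_iid P xi -> P.-integrable setT (EFin \o xi 0%N) ->
  (0 < k)%N -> 0 < e ->
  \int[P]_w (`|xi 0%N w| * ((k%:R < `|xi 0%N w|)%R : bool)%:R) <= e / 2 ->
  (P [set w | (k%:R * e < `|\sum_(i < k) xi i w - k%:R * \int[P]_w xi 0%N w|)%R]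
   <= ((1 + 4 / e ^+ 2) * \int[P]_w weight k%:R `|xi 0%N w|)%:E)%E.
Proof.
move=> iidxi ixi k0 e0 tail; have [mxi ind idd] := iidxi.
have kR : 0 < k%:R :> R by rewrite ltr0n.
have mnxi i : measurable_fun setT (fun w => `|xi i w|) by exact: measurableT_comp.
set a := \int[P]_w xi 0%N w.
(* Writing the truncation as [x - tl x] makes its bias the expectation of the tail, at most [e / 2]
   by hypothesis. *)
pose tl (x : R) := x * ((k%:R < `|x|)%R : bool)%:R.
pose g (x : R) := x - tl x.
have mtl : measurable_fun setT tl.
  apply: measurable_funM => //.
  by apply: (measurable_gt_ind (f := fun x : R => `|x|)).
have mg : measurable_fun setT g by exact: measurable_funB.
have gE x : `|x| <= k%:R -> g x = x.
  by move=> xk; rewrite /g /tl ltNge xk/= mulr0 subr0.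
have g0 x : k%:R < `|x| -> g x = 0.
  by move=> xk; rewrite /g /tl xk/= mulr1 subrr.
have gk x : `|g x| <= k%:R.
  have [xk|xk] := leP `|x| k%:R; first by rewrite gE.
  by rewrite g0// normr0 ltW.
have itl : P.-integrable setT (EFin \o (fun w => tl (xi 0%N w))) := tail_integrable k%:R ixi.
pose b := \int[P]_w g (xi 0%N w).
have mgxi : measurable_fun setT (fun w => g (xi 0%N w)) by exact: measurableT_comp.
have igxi : P.-integrable setT (EFin \o (fun w => g (xi 0%N w))).
  by apply: bounded_rv_integrable => //; exists k%:R.
have igxi2 : P.-integrable setT (EFin \o (fun w => g (xi 0%N w) ^+ 2)).
  apply: bounded_rv_integrable; first exact: measurable_funX.
  by apply: bounded_rvM; exists k%:R.
have ab : `|b - a| <= e / 2.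
  rewrite /b RintegralB// -/a [X in `|X|](_ : _ = - \int[P]_w tl (xi 0%N w)); last by ring.
  rewrite normrN (le_trans (le_normr_Rintegral _ itl))// (le_trans _ tail)//.
  rewrite le_eqVlt; apply/orP; left; apply/eqP; apply: eq_Rintegral => w _.
  by rewrite /tl normrM; case: (_ < _); rewrite ?normr1// normr0.
pose U i w := g (xi i w) - b.
have mgb : measurable_fun setT (fun x => g x - b).
  by apply: measurable_funB.
have iU : pairwise_iid P U := pairwise_iid_comp mgb iidxi.
have bU i : bounded_rv (U i).
  exists (k%:R + `|b|) => w; rewrite (le_trans (ler_normB _ _))// lerD2r.
  exact: gk.
have icst (c : R) : P.-integrable setT (EFin \o (fun=> c)).
  exact: finite_measure_integrable_cst.
have intcst := Rintegral_cst_probability P.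
have U0 : \int[P]_w U 0%N w = 0.
  by rewrite RintegralB// intcst subrr.
(* Centring at the mean [b] lowers the second moment by [b ^+ 2]. *)
have U2 : \int[P]_w (U 0%N w) ^+ 2 <= \int[P]_w (g (xi 0%N w)) ^+ 2.
  under eq_Rintegral => w _.
    rewrite (_ : _ ^+ 2 = (g (xi 0%N w)) ^+ 2 - (2 * b * g (xi 0%N w) - b ^+ 2)).
    over.
    by rewrite /U; ring.
  have i1 : P.-integrable setT (EFin \o (fun w => 2 * b * g (xi 0%N w))).
    have := integrableZl measurableT (2 * b) igxi.
    by apply: eq_integrable => // w _ /=; rewrite EFinM.
  have i2 : P.-integrable setT (EFin \o (fun w => 2 * b * g (xi 0%N w) - b ^+ 2)).
    exact: (integrableB measurableT i1 (icst _)).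
  rewrite RintegralB// RintegralB// RintegralZl// intcst -/b.
  by rewrite lerBlDr lerDl; nra.
pose B i := [set w | k%:R < `|xi i w|].
pose A1 := \big[setU/set0]_(i < k) B i.
pose A2 := [set w | k%:R * e / 2 < `|\sum_(i < k) U i w|].
have mB i : measurable (B i) by exact: measurable_gt_cst.
have mA1 : measurable A1 by apply: bigsetU_measurable => i _.
have mSU : measurable_fun setT (fun w => \sum_(i < k) U i w).
  by apply: measurable_sum => i; have [] := iU.
have mA2 : measurable A2.
  by apply: measurable_gt_cst; exact: measurableT_comp.
(* If no summand exceeds [k], truncation changes nothing; the bias uses up at most half of [k * e],
   and the centred sum must exceed the other half. *)
have sub : [set w | (k%:R * e < `|\sum_(i < k) xi i w - k%:R * a|)%R] `<=` A1 `|` A2.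
  move=> w /= we; have [wA1|wA1] := pselect (A1 w); [by left|right].
  have xk (i : 'I_k) : `|xi i w| <= k%:R.
    rewrite leNgt; apply/negP => h; apply: wA1.
    by rewrite /A1 -(bigcup_mkord k B); exists i => //=.
  have SE : \sum_(i < k) xi i w = \sum_(i < k) U i w + k%:R * b.
    rewrite /U sumrB sumr_const card_ord -(mulr_natl b k) subrK.
    by apply: eq_bigr => i _; rewrite gE.
  rewrite /A2/=; move: we; rewrite SE -addrA -mulrBr => we.
  have := ler_normD (\sum_(i < k) U i w) (k%:R * (b - a)).
  rewrite normrM (ger0_norm (ltW kR)).
  have : k%:R * `|b - a| <= k%:R * (e / 2) by rewrite ler_pM2l.
  move: we; set x := `|_ + _|; set y := `|\sum_(_ < _) _|; lra.
have mS : measurable_fun setT (fun w => \sum_(i < k) xi i w) by exact: measurable_sum.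
have P1 : (P A1 <= (\int[P]_w weight k%:R `|xi 0%N w|)%:E)%E.
  apply: (le_trans (Boole_inequality _ _)) => //.
  rewrite (eq_bigr (fun=> P (B 0%N))); last first.
    move=> i _; apply: (idd i [set x | k%:R < `|x|]).
    by apply: measurable_gt_cst.
  rewrite /B probability_gt// sumEFin lee_fin sumr_const card_ord -[X in X <= _]mulr_natl.
  have iI : P.-integrable setT (EFin \o (fun w => ((k%:R < `|xi 0%N w|)%R : bool)%:R : R)).
    apply: bounded_rv_integrable; first exact: measurable_gt_ind.
    by exists 1 => w; case: (_ < _); rewrite ?normr1// normr0.
  rewrite -RintegralZl//; apply: le_Rintegral => //.
  - have := integrableZl measurableT k%:R iI.
    by apply: eq_integrable => // w _ /=; rewrite EFinM.
  - exact: weight_integrable.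
  - move=> w _; case: ltP => kx; last by rewrite mulr0 weight_ge0// ltW.
    by rewrite mulr1 le_weight_tail// ltW.
(* The truncated second moment is at most [k] times the expected weight, by [le_weight_body], so the
   sum has second moment at most [k ^+ 2] times it; dividing by [(k * e / 2) ^+ 2] removes [k]. *)
have P2 : (P A2 <= (4 / e ^+ 2 * \int[P]_w weight k%:R `|xi 0%N w|)%:E)%E.
  have ke0 : 0 < k%:R * e / 2 by rewrite divr_gt0// mulr_gt0.
  apply: (le_trans (second_moment_tail ke0 mSU _)).
    apply: bounded_rv_integrable; first exact: measurable_funX.
    by apply: bounded_rvM; exact: bounded_rv_sum.
  rewrite lee_fin second_moment_sum//.
  have gw : \int[P]_w g (xi 0%N w) ^+ 2 <= k%:R * \int[P]_w weight k%:R `|xi 0%N w|.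
    rewrite -RintegralZl//; last exact: weight_integrable.
    apply: le_Rintegral => //.
      have := integrableZl measurableT k%:R (weight_integrable P kR (mxi 0%N)).
      by apply: eq_integrable => // w _ /=; rewrite EFinM.
    move=> w _; have [xk|xk] := leP `|xi 0%N w| k%:R.
      by rewrite gE// -real_normK ?num_real// le_weight_body.
    by rewrite g0// expr0n/= mulr_ge0 ?weight_ge0// ltW.
  have {U2 gw} := le_trans U2 gw.
  move: (\int[P]_w weight k%:R `|xi 0%N w|) (\int[P]_w (U 0%N w) ^+ 2) => v u uv.
  rewrite ler_pdivrMr ?exprn_gt0//.
  rewrite (_ : 4 / e ^+ 2 * v * (k%:R * e / 2) ^+ 2 = k%:R * (k%:R * v));
    last by field; rewrite gt_eqF.
  by rewrite ler_pM2l.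
apply: (le_trans (le_measure P _ _ sub)); rewrite ?inE//.
- apply: measurable_gt_cst; apply: measurableT_comp => //.
  exact: measurable_funB.
- exact: measurableU.
rewrite (le_trans (measureU2 P mA1 mA2))//.
by rewrite mulrDl mul1r EFinD leeD.
Qed.

(* Grows geometrically with ratio between [1 + 1/q] and [1 + 2/q] once [q <= n]. *)
Definition sparse (q n j : nat) : nat := iter j (fun k => k + (k %/ q).+1)%N n.

(** * Geometrically growing times *)

Arguments sparse : simpl never.

Lemma sparseS q n j :
  sparse q n j.+1 = (sparse q n j + (sparse q n j %/ q).+1)%N.
Proof. by []. Qed.

Lemma sparse_ge q n j : (n <= sparse q n j)%N.
Proof. by elim: j => // j IH; rewrite sparseS (leq_trans IH)// leq_addr. Qed.

Lemma sparse_bracket q n m : (n <= m)%N ->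
  exists j, (sparse q n j <= m < sparse q n j.+1)%N.
Proof.
move=> nm.
elim: m nm => [|m IH] nm.
  by exists 0%N; move: nm; rewrite leqn0 => /eqP ->; rewrite sparseS addnS.
move: nm; rewrite leq_eqVlt => /predU1P[->|nm].
  by exists 0%N; rewrite leqnn sparseS addnS ltnS leq_addr.
have [j /andP[jm mj]] := IH nm.
have [mj'|mj'] := ltnP m.+1 (sparse q n j.+1).
  by exists j; rewrite (leq_trans jm).
exists j.+1; rewrite mj' [sparse _ _ j.+2]sparseS.
by rewrite addnS ltnS (leq_trans mj)// leq_addr.
Qed.

Section sparse_real.
Context {R : realType} (q n : nat).
Hypotheses (q2 : (1 < q)%N) (qn : (q <= n)%N).

Lemma sparse_gt0 j : 0 < (sparse q n j)%:R :> R.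
Proof. by rewrite ltr0n; have := sparse_ge q n j; lia. Qed.

Lemma sparse_step_ge j :
  (sparse q n j)%:R <= q%:R * ((sparse q n j.+1)%:R - (sparse q n j)%:R) :> R.
Proof.
rewrite sparseS natrD addrAC subrr add0r -natrM ler_nat.
by rewrite mulnC ltnW// ltn_ceil//; lia.
Qed.

Lemma sparse_step_le j :
  q%:R * ((sparse q n j.+1)%:R - (sparse q n j)%:R) <= 2 * (sparse q n j)%:R :> R.
Proof.
rewrite sparseS natrD addrAC subrr add0r -!natrM ler_nat.
have := sparse_ge q n j; have := leq_trunc_div (sparse q n j) q.
by rewrite mulnC mulnS mulSn mul1n; lia.
Qed.

Lemma sparse_double j : (sparse q n j.+1)%:R <= 2 * (sparse q n j)%:R :> R.
Proof.
have := sparse_step_le j; have : 2 <= q%:R :> R by rewrite ler_nat.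
have := sparse_step_ge j; have := sparse_gt0 j; nra.
Qed.

End sparse_real.

(** * The strong law along the sparse times and between them *)

Lemma potential_integrable d (T : measurableType d) (R : realType)
    (P : probability T R) (f : T -> R) (k : R) : 0 < k ->
  P.-integrable setT (EFin \o f) ->
  P.-integrable setT (EFin \o (fun w => `|f w| ^+ 2 / (k + `|f w|))).
Proof.
move=> k0 fi; have mf : measurable_fun setT f by apply/measurable_EFinP; case/integrableP : fi.
apply: (le_integrable measurableT _ _ fi).
  apply/measurable_EFinP.
  have mg : measurable_fun setT (fun x : R => `|x| ^+ 2 / (k + `|x|)).
    apply: continuous_measurable_fun => x.
    apply: cvgM.
      by apply: (cvgM (f := fun x => `|x|) (g := fun x => `|x|)); exact: norm_continuous.
    apply: cvgV; first by rewrite gt_eqF// ltr_wpDr.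
    by apply: cvgD; [exact: cvg_cst|exact: norm_continuous].
  exact: (measurableT_comp mg).
move=> w _ /=; rewrite lee_fin ger0_norm ?divr_ge0 ?sqr_ge0 ?addr_ge0 ?(ltW k0)//.
by rewrite ler_pdivrMr ?ltr_wpDr//; have := normr_ge0 (f w); nra.
Qed.

(** Summing [weak_law] over the sparse times, [weight_telescope] bounds the errors by increments of
    the potential [V]. The sum collapses to at most [V 0], whose time is [n] itself, and
    [weight_potential_le] bounds [V 0]. *)
Lemma sparse_law d (T : measurableType d) (R : realType) (P : probability T R)
    (xi : nat -> T -> R) (q n : nat) (e K : R) :
  pairwise_iid P xi -> P.-integrable setT (EFin \o xi 0%N) ->
  (1 < q)%N -> (q <= n)%N -> 0 < e ->
  (forall k, (n <= k)%N ->
    \int[P]_w (`|xi 0%N w| * ((k%:R < `|xi 0%N w|)%R : bool)%:R) <= e / 2) ->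
  (P (\bigcup_j [set w | ((sparse q n j)%:R * e <
      `|\sum_(i < sparse q n j) xi i w - (sparse q n j)%:R * \int[P]_w xi 0%N w|)%R])
   <= ((1 + 4 / e ^+ 2) * (8 * q%:R *
        (\int[P]_w (`|xi 0%N w| * ((K < `|xi 0%N w|)%R : bool)%:R) + K ^+ 2 / n%:R)))%:E)%E.
Proof.
move=> iidxi ixi q2 qn e0 tail; have [mxi _ _] := iidxi.
have k0 j := @sparse_gt0 R q n q2 qn j.
set B := fun j => [set w | _].
have mB j : measurable (B j).
  apply: measurable_gt_cst; apply: measurableT_comp => //.
  by apply: measurable_funB => //; exact: measurable_sum.
set C := 1 + 4 / e ^+ 2.
have C0 : 0 <= C by rewrite addr_ge0// divr_ge0// sqr_ge0.
pose V j := \int[P]_w (`|xi 0%N w| ^+ 2 / ((sparse q n j)%:R + `|xi 0%N w|)).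
have iV j := potential_integrable (k0 j) ixi.
have V0 j : 0 <= V j.
  by apply: Rintegral_ge0 => w _; rewrite divr_ge0 ?sqr_ge0 ?addr_ge0.
have PB j : (P (B j) <= (C * (8 * q%:R * (V j - V j.+1)))%:E)%E.
  apply: (le_trans (weak_law iidxi ixi _ e0 _)).
  - by have := sparse_ge q n j; lia.
  - by apply: tail; exact: sparse_ge.
  - rewrite lee_fin ler_wpM2l// -RintegralB// -RintegralZl//; last first.
      exact: (integrableB measurableT (iV _) (iV _)).
    apply: le_Rintegral => //; first exact: weight_integrable.
      have := integrableZl measurableT (8 * q%:R) (integrableB measurableT (iV j) (iV j.+1)).
      by apply: eq_integrable => // w _ /=; rewrite EFinM.
    move=> w _; apply: weight_telescope => //.
    + exact: sparse_step_ge.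
    + exact: sparse_double.
    + by rewrite ltr0n; lia.
have V0le : V 0%N <= \int[P]_w (`|xi 0%N w| * ((K < `|xi 0%N w|)%R : bool)%:R) + K ^+ 2 / n%:R.
  have itl : P.-integrable setT (EFin \o
      (fun w => `|xi 0%N w| * ((K < `|xi 0%N w|)%R : bool)%:R)) :=
    norm_tail_integrable K ixi.
  have icst : P.-integrable setT (EFin \o (fun=> K ^+ 2 / n%:R)).
    exact: finite_measure_integrable_cst.
  rewrite -[X in _ <= _ + X](Rintegral_cst_probability P).
  rewrite -RintegralD//; apply: le_Rintegral => //.
    exact: (integrableD measurableT itl icst).
  by move=> w _; apply: weight_potential_le.
apply: (le_trans (generalized_Boole_inequality P mB _)).
  exact: bigcupT_measurable.
apply: lime_le; first by apply: is_cvg_nneseries => j _ _; exact: measure_ge0.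
apply: nearW => J.
apply: (@le_trans _ _ (\sum_(0 <= j < J) (C * (8 * q%:R * (V j - V j.+1)))%:E)%E).
  by apply: lee_sum => j _; exact: PB.
rewrite sumEFin lee_fin -mulr_sumr ler_wpM2l// -mulr_sumr ler_wpM2l//.
under eq_bigr do rewrite -opprB.
rewrite sumrN telescope_sumr// opprB (le_trans _ V0le)//.
by rewrite lerBlDr lerDl.
Qed.

(* Etemadi's device: between two consecutive sparse times the partial sums of [y]
move by at most the increment of the partial sums of [|y|], which is controlled by
the law of large numbers for [|y|]. *)
Lemma sparse_interpolation (R : realType) (y : nat -> R) (q n m : nat) (a e M : R) :
  (1 < q)%N -> (q <= n)%N -> 0 < e -> 0 <= a -> a <= M -> 2 * M <= q%:R * e ->
  (forall j, `|\sum_(i < sparse q n j) y i| <= (sparse q n j)%:R * e) ->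
  (forall j, `|\sum_(i < sparse q n j) `|y i| - (sparse q n j)%:R * a|
     <= (sparse q n j)%:R * e) ->
  (n <= m)%N -> `|\sum_(i < m) y i| <= m%:R * (5 * e).
Proof.
move=> q2 qn e0 a0 aM Mq hy habs nm.
have [j /andP[jm mj]] := sparse_bracket q nm.
have kk1 : (sparse q n j <= sparse q n j.+1)%N by rewrite sparseS leq_addr.
have step := @sparse_step_le R q n q2 qn j.
have dbl := @sparse_double R q n q2 qn j.
have k0 := @sparse_gt0 R q n q2 qn j.
have kkR : (sparse q n j)%:R <= (sparse q n j.+1)%:R :> R by rewrite ler_nat.
have kmR : (sparse q n j)%:R <= m%:R :> R by rewrite ler_nat.
have h0 := hy j; have h1 := habs j; have h2 := habs j.+1.
move: jm mj kk1 step dbl k0 kkR kmR h0 h1 h2.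
move: (sparse q n j) (sparse q n j.+1) => k k' jm mj kk1 step dbl k0 kkR kmR h0 h1 h2.
have E1 : \sum_(i < m) y i = \sum_(i < k) y i + \sum_(k <= i < m) y i.
  by rewrite -!(big_mkord xpredT y) -big_cat_nat.
have E2 : \sum_(i < k') `|y i| = \sum_(i < k) `|y i| + \sum_(k <= i < k') `|y i|.
  by rewrite -!(big_mkord xpredT (fun i => `|y i|)) -big_cat_nat.
have le1 : `|\sum_(k <= i < m) y i| <= \sum_(k <= i < k') `|y i|.
  rewrite (le_trans (ler_norm_sum _ _ _))//.
  rewrite [leRHS](@big_cat_nat _ _ _ m)//=; last exact: ltnW.
  by rewrite lerDl sumr_ge0.
have qR : 0 < q%:R :> R by rewrite ltr0n ltnW.
(* The gap satisfies [q * (k' - k) <= 2 * k], so taking [q] large compared with [M / e] makes the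
   mean increment over it negligible. *)
have le2 : a * (k'%:R - k%:R) <= k%:R * e.
  rewrite -(ler_pM2l qR) (le_trans (_ : _ <= M * (2 * k%:R)))//.
    by rewrite mulrCA ler_pM// mulr_ge0 ?subr_ge0// ltW.
  rewrite (_ : M * _ = k%:R * (2 * M)); last by ring.
  by rewrite [leRHS]mulrCA; apply: ler_wpM2l => //; exact: ltW.
(* The 5 is made up of 1 for the sum up to [k], 1 for the mean increment, and 1 + 2 for the errors
   of the absolute sums at [k] and at [k' <= 2 * k]. *)
rewrite E1 (le_trans (ler_normD _ _))//.
move: h1 h2; rewrite E2 !ler_norml => /andP[h1 _] /andP[_ h2].
have : k%:R * (5 * e) <= m%:R * (5 * e) by rewrite ler_wpM2r//; lra.
have : k'%:R * e <= 2 * k%:R * e by rewrite ler_pM2r.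
lra.
Qed.

(** The factor 2 comes from applying [sparse_law] both to [xi] and to its absolute values, which
    have the same tail integrals. Off both exceptional events [sparse_interpolation] covers every
    time from [n] on. *)
Lemma sparse_deviation d (T : measurableType d) (R : realType) (P : probability T R)
    (xi : nat -> T -> R) (q n : nat) (e K M : R) :
  pairwise_iid P xi -> P.-integrable setT (EFin \o xi 0%N) ->
  \int[P]_w xi 0%N w = 0 ->
  (1 < q)%N -> (q <= n)%N -> 0 < e ->
  (forall k, (n <= k)%N ->
    \int[P]_w (`|xi 0%N w| * ((k%:R < `|xi 0%N w|)%R : bool)%:R) <= e / 2) ->
  \int[P]_w `|xi 0%N w| <= M -> 2 * M <= q%:R * e ->
  (P (\bigcup_(m in [set m | (n <= m)%N])
      [set w | (m%:R * (5 * e) < `|\sum_(i < m) xi i w|)%R])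
   <= (2 * ((1 + 4 / e ^+ 2) * (8 * q%:R *
        (\int[P]_w (`|xi 0%N w| * ((K < `|xi 0%N w|)%R : bool)%:R) + K ^+ 2 / n%:R))))%:E)%E.
Proof.
move=> iidxi ixi xi0 q2 qn e0 tail aM Mq; have [mxi _ _] := iidxi.
pose zeta i w := `|xi i w|.
have iidz : pairwise_iid P zeta.
  exact: (pairwise_iid_comp (g := fun x : R => `|x|) _ iidxi).
have [mz _ _] := iidz.
have iz : P.-integrable setT (EFin \o zeta 0%N) by exact: integrable_norm ixi.
have L1 := sparse_law K iidxi ixi q2 qn e0 tail.
have zz c : (fun w => `|zeta 0%N w| * ((c < `|zeta 0%N w|)%R : bool)%:R) =
            (fun w => `|xi 0%N w| * ((c < `|xi 0%N w|)%R : bool)%:R).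
  by apply/funext => w; rewrite /zeta normr_id.
have tz k : (n <= k)%N ->
    \int[P]_w (`|zeta 0%N w| * ((k%:R < `|zeta 0%N w|)%R : bool)%:R) <= e / 2.
  by rewrite zz; exact: tail.
have L2 := sparse_law K iidz iz q2 qn e0 tz.
rewrite zz in L2; rewrite xi0 in L1.
set B1 := \bigcup_j _ in L1; set B2 := \bigcup_j _ in L2.
have mB1 : measurable B1.
  apply: bigcupT_measurable => j.
  apply: measurable_gt_cst; apply: measurableT_comp => //.
  by apply: measurable_funB => //; exact: measurable_sum.
have mB2 : measurable B2.
  apply: bigcupT_measurable => j.
  apply: measurable_gt_cst; apply: measurableT_comp => //.
  by apply: measurable_funB => //; exact: measurable_sum.
apply: (@le_trans _ _ (P (B1 `|` B2))); last first.
  rewrite (le_trans (measureU2 P mB1 mB2))//.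
  by rewrite mulrDl mul1r EFinD leeD.
apply: le_measure; rewrite ?inE.
- apply: bigcup_measurable => m _.
  by apply: measurable_gt_cst; apply: measurableT_comp => //; exact: measurable_sum.
- exact: measurableU.
move=> w [m /= nm dev]; apply: contrapT => /not_orP[nB1 nB2].
move: dev; apply/negP; rewrite -leNgt.
apply: (@sparse_interpolation _ (xi ^~ w) q n m (\int[P]_w zeta 0%N w) e M) => //.
- by apply: Rintegral_ge0 => v _; exact: normr_ge0.
- move=> j; rewrite leNgt; apply/negP => h; apply: nB1; exists j => //=.
  by rewrite mulr0 subr0.
- by move=> j; rewrite leNgt; apply/negP => h; apply: nB2; exists j.
Qed.

(** * Deviations of the averages, uniformly over the family *)

Definition average {T : Type} {R : realType} (X : nat -> T -> R) (m : nat) (w : T) : R :=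
  m%:R^-1 * \sum_(1 <= i < m.+1) X i w.

Lemma measurable_average d (T : measurableType d) (R : realType) (X : nat -> T -> R) m :
  (forall i, (0 < i <= m)%N -> measurable_fun setT (X i)) ->
  measurable_fun setT (average X m).
Proof.
move=> mX; apply: measurable_funM => //.
rewrite (_ : (fun w => _) = (fun w => \sum_(i < m) X i.+1 w)); last first.
  by apply/funext => w; rewrite big_add1 big_mkord.
elim: m mX => [|m IH] mX.
  by under eq_fun do rewrite big_ord0; exact: measurable_cst.
under eq_fun do rewrite big_ord_recr/=.
apply: measurable_funD; last by apply: mX; rewrite leqnn.
by apply: IH => i /andP[i0 im]; apply: mX; rewrite i0 (leq_trans im).
Qed.

Lemma iid_pairwise d (T : measurableType d) (R : realType) (P : probability T R)
    (X : nat -> T -> R) :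
  (forall i, (0 < i)%N -> measurable_fun setT (X i)) -> iid P X ->
  pairwise_iid P (fun i => X i.+1).
Proof.
move=> mX [ind idd]; split=> [i|i j A B ij mA mB|i B mB]; first exact: mX.
- pose C k := if k == i.+1 then A else B.
  have ji : (j.+1 == i.+1) = false by rewrite eqSS eq_sym (negbTE ij).
  have := ind [:: i.+1; j.+1] C.
  rewrite !big_cons big_nil mule1 /C eqxx ji /= => <- //.
  + congr (P _); apply/seteqP; split => [w [wA wB] k /=|w wAB].
      rewrite !inE => /orP[|] /eqP -> /=; first by rewrite eqxx.
      by rewrite ji.
    split.
      by have := wAB i.+1; rewrite /= eqxx; apply; rewrite inE eqxx.
    by have := wAB j.+1; rewrite /= ji; apply; rewrite !inE eqxx orbT.
  + by rewrite inE eqSS ij.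
  + by move=> k; case: (_ == _).
- exact: idd.
Qed.

(** Turns the extended-real limit into real bounds with a threshold independent of [P]: near
    infinity the supremum is finite and below [e], and it dominates each tail integral. *)
Lemma uniform_tail d (T : measurableType d) (R : realType)
    (Pfam : set (probability T R)) (f : probability T R -> T -> R) :
  (forall P, Pfam P -> P.-integrable setT (EFin \o f P)) ->
  (fun K : R => supP Pfam (fun P =>
      (\int[P]_w ((`|f P w| * ((K < `|f P w|)%R : bool)%:R)%:E))%E)) @ +oo --> 0%E ->
  forall e : R, 0 < e -> exists2 K0 : R, 0 <= K0 & forall K P, K0 <= K -> Pfam P ->
    \int[P]_w (`|f P w| * ((K < `|f P w|)%R : bool)%:R) <= e.
Proof.
move=> fi /fine_cvgP[finn cv] e e0.
set S := (fun K : R => supP _ _) in finn cv.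
have [M1 [_ fin1]] := finn.
have [M2 [_ lt2]] : \forall K \near +oo, fine (S K) < e := cvgr_lt _ cv _ e0.
pose M := Num.max M1 M2.
have H K : M < K -> (S K < e%:E)%E.
  rewrite gt_max => /andP[/fin1 SK /lt2 SKe].
  by rewrite -(fineK (SK : S K \is a fin_num)) lte_fin.
exists (Num.max 0 (M + 1)); first by rewrite le_max lexx.
move=> K P; rewrite ge_max => /andP[_ MK] PP.
have {}MK : M < K by lra.
have itl : P.-integrable setT (EFin \o
    (fun w => `|f P w| * ((K < `|f P w|)%R : bool)%:R)) :=
  norm_tail_integrable K (fi P PP).
rewrite -lee_fin /Rintegral fineK ?integrable_fin_num//.
apply/ltW/(le_lt_trans _ (H K MK)).
by apply: ereal_sup_ubound; right; exists P.
Qed.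

(** The mean depends on [P], but it cancels in the difference of two averages. The event is thus the
    same for every [P], while its probability is estimated through the centred variables [Y P]. *)
Lemma uniform_deviation d (T : measurableType d) (R : realType)
    (Pfam : set (probability T R)) (X : nat -> T -> R) :
  (forall i, (0 < i)%N -> measurable_fun setT (X i)) ->
  (forall P, Pfam P -> iid P X) ->
  (forall P, Pfam P -> P.-integrable setT (EFin \o X 1%N)) ->
  (fun K : R => supP Pfam (fun P =>
      (\int[P]_w ((`|X 1%N w - fine 'E_P[X 1%N]| *
                  ((K < `|X 1%N w - fine 'E_P[X 1%N]|)%R : bool)%:R)%:E))%E))
    @ +oo --> 0%E ->
  forall e delta : R, 0 < e -> 0 < delta -> exists2 n : nat, (0 < n)%N &
    forall P, Pfam P ->
    (P (\bigcup_(m in [set m | (n <= m)%N])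
        [set w | (e < `|average X m w - average X n w|)%R]) <= delta%:E)%E.
Proof.
move=> mX iidX iX ui e delta e0 delta0.
pose mu (P : probability T R) := fine 'E_P[X 1%N].
pose Y (P : probability T R) i w := X i.+1 w - mu P.
have icst (P : probability T R) (c : R) : P.-integrable setT (EFin \o (fun=> c)).
  exact: finite_measure_integrable_cst.
have iY P : Pfam P -> P.-integrable setT (EFin \o Y P 0%N).
  by move=> PP; exact: (integrableB measurableT (iX P PP) (icst P _)).
have iidY P : Pfam P -> pairwise_iid P (Y P).
  move=> PP; apply: (pairwise_iid_comp (g := fun x => x - mu P)).
    exact: measurable_funB.
  by apply: iid_pairwise => //; exact: iidX.
have Y0 P : Pfam P -> \int[P]_w Y P 0%N w = 0.
  move=> PP; rewrite (RintegralB measurableT (iX P PP) (icst P _)).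
  by rewrite Rintegral_cst_probability /mu unlock subrr.
have tail := uniform_tail iY ui.
(* Each of the two averages compared deviates from the mean by at most [5 * e']. *)
pose e' := e / 10.
have e'0 : 0 < e' by rewrite divr_gt0.
have [K1 K10 HK1] := tail 1 ltr01.
(* A first absolute moment bound uniform in [P]: at most 1 from the tail above [K1], at most [K1]
   from the rest. *)
pose M := 1 + K1.
have HM P : Pfam P -> \int[P]_w `|Y P 0%N w| <= M.
  move=> PP; have itl : P.-integrable setT (EFin \o
      (fun w => `|Y P 0%N w| * ((K1 < `|Y P 0%N w|)%R : bool)%:R)) :=
    norm_tail_integrable K1 (iY P PP).
  apply: (@le_trans _ _ (\int[P]_w (`|Y P 0%N w| * ((K1 < `|Y P 0%N w|)%R : bool)%:R + K1))).
    apply: le_Rintegral => //.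
    - exact: (integrable_norm (iY P PP)).
    - exact: (integrableD measurableT itl (icst P K1)).
    - by move=> w _; case: ltP => h; rewrite ?mulr1 ?mulr0 ?add0r// lerDl.
  by rewrite (RintegralD measurableT itl (icst P K1)) Rintegral_cst_probability lerD2r; exact: HK1.
(* Large enough for [2 * M <= q * e']; the two successors ensure [1 < q]. *)
pose q := (Num.bound (2 * M / e')).+2.
have Mq : 2 * M <= q%:R * e'.
  rewrite -ler_pdivrMr//.
  have M0 : 0 <= 2 * M / e' by rewrite divr_ge0 ?(ltW e'0)// mulr_ge0// addr_ge0.
  rewrite (le_trans (ltW (archi_boundP M0)))// ler_nat.
  exact: leqW (leqnSn _).
pose D := 2 * ((1 + 4 / e' ^+ 2) * (8 * q%:R)) : R.
have D0 : 0 < D.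
  rewrite mulr_gt0// mulr_gt0//; last by rewrite mulr_gt0// ltr0n.
  by rewrite ltr_wpDr// divr_ge0// sqr_ge0.
(* The bound of [sparse_deviation] is [D] times a tail integral plus [K ^+ 2 / n]; each of these two
   terms is to be at most [delta / (2 * D)]. *)
have dD0 : 0 < delta / (2 * D) by rewrite divr_gt0// mulr_gt0.
have [K K0 HK] := tail _ dD0.
have [K2 K20 HK2] := tail _ (divr_gt0 e'0 (ltr0n R 2)).
pose n1 := Num.bound (K ^+ 2 / (delta / (2 * D))).
have Hn1 : K ^+ 2 / (delta / (2 * D)) <= n1%:R.
  by apply/ltW/archi_boundP; rewrite divr_ge0 ?sqr_ge0// ltW.
have Hn2 : K2 <= (Num.bound K2)%:R by exact/ltW/archi_boundP.
(* The three summands secure [q <= n], the bound on [K ^+ 2 / n], and small tails at all levels from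
   [n] on. *)
pose n := (q + n1 + Num.bound K2)%N.
have n0 : (0 < n)%N by rewrite /n /q !addSn.
exists n => // P PP.
have tn k : (n <= k)%N ->
    \int[P]_w (`|Y P 0%N w| * ((k%:R < `|Y P 0%N w|)%R : bool)%:R) <= e' / 2.
  move=> nk; apply: HK2 => //; rewrite (le_trans Hn2)// ler_nat.
  by rewrite (leq_trans _ nk)// leq_addl.
have q2 : (1 < q)%N by [].
have qn : (q <= n)%N by rewrite /n -addnA leq_addr.
have dev := sparse_deviation K (iidY P PP) (iY P PP) (Y0 P PP) q2 qn e'0 tn (HM P PP) Mq.
have mY i : measurable_fun setT (Y P i) by have [] := iidY P PP.
apply: (le_trans (le_measure P _ _ _)); [| |  |apply: (le_trans dev)]; rewrite ?inE.
- apply: bigcup_measurable => m _; apply: measurable_gt_cst.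
  apply: measurableT_comp => //; apply: measurable_funB;
    by apply: measurable_average => i /andP[i0 _]; exact: mX.
- apply: bigcup_measurable => m _; apply: measurable_gt_cst.
  by apply: measurableT_comp => //; exact: measurable_sum.
- move=> w [m /= nm em]; apply: contrapT => nB.
  have H k : (n <= k)%N -> `|average X k w - mu P| <= 5 * e'.
    move=> nk; have k0 : 0 < k%:R :> R by rewrite ltr0n (leq_trans n0).
    have -> : average X k w - mu P = (\sum_(i < k) Y P i w) / k%:R.
      rewrite /average big_add1 big_mkord/= /Y sumrB sumr_const card_ord.
      by rewrite -(mulr_natl (mu P) k); field; rewrite gt_eqF.
    rewrite normrM normfV (gtr0_norm k0) ler_pdivrMr// mulrC leNgt.
    by apply/negP => h; apply: nB; exists k.
  have h1 := H m nm; have h2 := H n (leqnn n).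
  move: em; apply/negP; rewrite -leNgt.
  rewrite (_ : average X m w - average X n w =
    (average X m w - mu P) - (average X n w - mu P)); last by ring.
  rewrite (le_trans (ler_normB _ _))//.
  by move: h1 h2; rewrite /e'; lra.
- rewrite lee_fin (_ : 2 * _ = D * (\int[P]_w (`|Y P 0%N w| *
    ((K < `|Y P 0%N w|)%R : bool)%:R) + K ^+ 2 / n%:R)); last by rewrite /D; ring.
  have t1 := HK K P (lexx _) PP.
  have t2 : K ^+ 2 / n%:R <= delta / (2 * D).
    rewrite ler_pdivrMr ?ltr0n// mulrC -ler_pdivrMr// (le_trans Hn1)// ler_nat.
    by rewrite /n addnAC leq_addl.
  rewrite mulrC -ler_pdivlMr// (le_trans (lerD t1 t2))//.
  by rewrite le_eqVlt; apply/orP; left; apply/eqP; field; rewrite gt_eqF.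
Qed.

(** * Stopping times, the divergence event and the conclusion *)

Lemma sigma_algebra_measurable (T : pointedType) (R : realType)
    (G : set (set T)) (f : T -> R) (B : set R) :
  sigma_algebra setT G ->
  measurable_fun (setT : set (g_sigma_algebraType G)) f -> measurable B ->
  G (f @^-1` B).
Proof.
move=> sG mf mB; rewrite -(sigma_algebra_id sG) -[_ @^-1` _]setTI.
exact: (mf measurableT).
Qed.

(** The first [m] with [D m w] works: it is at most [t] exactly on the union of the [D m] with
    [m <= t], which lies in [F t] because the filtration increases. *)
Lemma hitting_time d (Omega : measurableType d) (F : nat -> set (set Omega))
    (D : nat -> set Omega) :
  filtration_of F -> (forall m, F m (D m)) ->
  exists2 tau, stopping_time F tau & finite_time tau = \bigcup_m D m.
Proof.
move=> [sF [Fmono _]] FD.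
pose hits w m := `[< D m w >].
pose tau w := if pselect (exists m, hits w m) is left h then Some (ex_minn h) else None.
have tauD w m : D m w -> exists s, [/\ tau w = Some s, (s <= m)%N & D s w].
  move=> Dm; rewrite /tau; case: pselect => [h|]; last by case; exists m; exact/asboolP.
  exists (ex_minn h); split => //; case: ex_minnP => s /asboolP Ds smin //.
  by apply: smin; exact/asboolP.
have tauN w s : tau w = Some s -> D s w.
  by rewrite /tau; case: pselect => // h [<-]; case: ex_minnP => k /asboolP.
exists tau => [t|].
- have [F0 _ FU] := sF t.
  rewrite (_ : [set w | _] = \bigcup_m (if (m <= t)%N then D m else set0)).
    by apply: FU => m; case: ifP => // /Fmono; apply.
  apply/seteqP; split => w /=.
    by move=> [s [ws st]]; exists s => //; rewrite st; exact: tauN.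
  move=> [m _]; case: ifP => // mt /tauD[s [ws sm _]].
  by exists s; split => //; exact: leq_trans mt.
- apply/seteqP; split => w /=.
    by rewrite /finite_time/=; case E: (tau w) => [s|//] _; exists s => //; exact: tauN.
  by move=> [m _ /tauD[s [ws _ _]]]; rewrite /finite_time/= ws.
Qed.

(** Outside the right-hand side the averages from time [n k] on stay within [1 / (k + 1)] of the one
    at [n k], for every [k]; they are Cauchy and converge by completeness. *)
Lemma A_div_sub (Omega : Type) (R : realType) (X : nat -> Omega -> R) (n : nat -> nat) :
  A_div X `<=` \bigcup_k \bigcup_(m in [set m | (n k <= m)%N])
    [set w | k.+1%:R^-1 < `|average X m w - average X (n k) w|].
Proof.
move=> w Aw; apply: contrapT => nw; apply: Aw.
suff : cvg (average X t w @[t --> \oo]) by move=> c; exists (lim (average X t w @[t --> \oo])).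
apply/cauchy_cvgP/cauchy_exP => e e0.
pose k := Num.bound e^-1.
have ke : k.+1%:R^-1 < e.
  rewrite invf_plt ?posrE ?ltr0n//.
  have e1 : 0 <= e^-1 by rewrite invr_ge0 ltW.
  by rewrite (lt_le_trans (archi_boundP e1))// ler_nat.
exists (average X (n k) w); exists (n k) => // m /= nm.
rewrite /ball/= distrC (le_lt_trans _ ke)// leNgt; apply/negP => h.
by apply: nw; exists k => //; exists m.
Qed.

Theorem mainTheorem8 (d : measure_display) (Omega : measurableType d)
  (R : realType) (F : nat -> set (set Omega)) (X : nat -> Omega -> R)
  (Pfam : set (probability Omega R)) :
  filtration_of F ->
  (forall t, (0 < t)%N -> forall B : set R, measurable B -> F t (X t @^-1` B)) ->
  (forall P, Pfam P -> iid P X) ->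
  (forall P, Pfam P -> P.-integrable setT (fun w => (X 1%N w)%:E)) ->
  (fun K : R => supP Pfam (fun P =>
      (\int[P]_w ((`|X 1%N w - fine 'E_P[X 1%N]| *
                  ((K < `|X 1%N w - fine 'E_P[X 1%N]|)%R : bool)%:R)%:E))%E))
    @ +oo --> 0%E ->
  mu_star F Pfam (A_div X) = 0%E.
Proof.
move=> filt adapt iidX iX ui; have [sF [Fmono Fgen]] := filt.
have mX i : (0 < i)%N -> measurable_fun setT (X i).
  move=> i0 _ B mB; rewrite setTI Fgen; apply: sub_sigma_algebra.
  by exists i => //; exact: adapt.
have supP_ge0 f : (0 <= supP Pfam f)%E by apply: ereal_sup_ubound; left.
apply/eqP; rewrite eq_le; apply/andP; split; last first.
  by apply/ereal_infP => _ [tau _ <-].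
apply/lee_addgt0Pr => e e0; rewrite add0e.
have dev := uniform_deviation mX iidX iX ui.
(* Uniformity in [P] allows one choice of [n k] for the whole family, hence a single stopping
   time. *)
have [n Hn] : {n : nat -> nat & forall k, (0 < n k)%N /\ forall P, Pfam P ->
    (P (\bigcup_(m in [set m | (n k <= m)%N])
      [set w | (k.+1%:R^-1 < `|average X m w - average X (n k) w|)%R])
      <= (e / (2 ^ k.+1)%:R)%:E)%E}.
  apply: (@choice _ _ (fun k n => (0 < n)%N /\ forall P, Pfam P ->
    (P (\bigcup_(m in [set m | (n <= m)%N])
      [set w | (k.+1%:R^-1 < `|average X m w - average X n w|)%R])
      <= (e / (2 ^ k.+1)%:R)%:E)%E)) => k.
  have [||n n0 Hn] := dev k.+1%:R^-1 (e / (2 ^ k.+1)%:R); last by exists n.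
    by rewrite invr_gt0 ltr0n.
  by rewrite divr_gt0// ltr0n expn_gt0.
pose E k m := [set w | k.+1%:R^-1 < `|average X m w - average X (n k) w|].
(* At time [m] only the bounds with [n k <= m] are tested, so both averages in [E k m] are known by
   time [m]. *)
pose D m := \bigcup_k (if (n k <= m)%N then E k m else set0).
have FD m : F m (D m).
  have [F0 _ FU] := sF m; apply: FU => k; case: ifP => // nm.
  have mXm i : (0 < i <= m)%N ->
      measurable_fun (setT : set (g_sigma_algebraType (F m))) (X i).
    move=> /andP[i0 im] _ B mB; rewrite setTI; apply: sub_sigma_algebra.
    by apply: (Fmono _ _ im); exact: adapt.
  rewrite (_ : E k m = (fun w => `|average X m w - average X (n k) w|) @^-1`
      `]k.+1%:R^-1, +oo[); last by apply/seteqP; split => w /=; rewrite in_itv/= andbT.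
  apply: sigma_algebra_measurable => //.
  apply: measurableT_comp => //; apply: measurable_funB.
    exact: measurable_average.
  apply: measurable_average => i /andP[i0 im].
  by apply: mXm; rewrite i0 (leq_trans im).
have [tau st ftau] := hitting_time filt FD.
(* Exchanging the unions passes from the indexing by time, which yields the stopping time, to the
   indexing by [k], which suits the union bound. *)
have DE : \bigcup_m D m = \bigcup_k \bigcup_(m in [set m | (n k <= m)%N]) E k m.
  apply/seteqP; split => w.
    by move=> [m _ [k _]]; case: ifP => // nm h; exists k => //; exists m.
  by move=> [k _ [m /= nm h]]; exists m => //; exists k => //; rewrite nm.
have mE k m : measurable (E k m).
  apply: measurable_gt_cst; apply: measurableT_comp => //; apply: measurable_funB;
    by apply: measurable_average => i /andP[i0 _]; exact: mX.
apply: (@le_trans _ _ (supP Pfam (fun P => P (finite_time tau)))).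
  apply: ereal_inf_lbound; exists tau => //; split => //.
  by rewrite ftau DE; exact: A_div_sub.
apply/ereal_supP => _ [->|[P PP <-]]; first by rewrite lee_fin ltW.
rewrite ftau DE.
apply: (le_trans (generalized_Boole_inequality P _ _)).
- by move=> k; apply: bigcup_measurable.
- by apply: bigcupT_measurable => k; apply: bigcup_measurable.
(* The budgets [e / 2 ^ k.+1] sum to at most [e]. *)
apply: le_trans (epsilon_trick0 xpredT (ltW e0)).
apply: lee_nneseries => [k _ _|k _]; first exact: measure_ge0.
exact: (Hn k).2.
Qed.
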